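(* Let $\beta\in(1,2)$ be approximation regular and suppose $\Psi:\mathbb{N}\to\mathbb{R}_{\geq 0}$ is decaying regularly and satisfies $\sum_{n=1}^{\infty}2^{n}\Psi(n)=\infty$. Then for Lebesgue almost every $x\in I_{\beta}$ there exists a $\beta$-expansion $(\epsilon_{i})_{i=1}^{\infty}$ of $x$ such that the inequalities $$0\leq x-\sum_{i=1}^{n}\frac{\epsilon_{i}}{\beta^{i}}\leq \Psi(n)$$ hold for infinitely many $n\in\mathbb{N}$.
   Context: $\mathbb{N}=\{1,2,3,\ldots\}$. For $\beta\in(1,2)$ let $I_{\beta}:=[0,\frac{1}{\beta-1}]$. A $\beta$-expansion of $x\in I_\beta$ is a sequence $(\epsilon_{i})_{i=1}^{\infty}\in\{0,1\}^{\mathbb{N}}$ with $x=\sum_{i=1}^{\infty}\epsilon_{i}\beta^{-i}$. For $\Phi:\mathbb{N}\to\mathbb{R}_{\geq 0}$ let $$W_{\beta}(\Phi):=\bigcap_{m=1}^{\infty}\bigcup_{n=m}^{\infty}\bigcup_{(\epsilon_{i})_{i=1}^{n}\in\{0,1\}^{n}}\Big[\sum_{i=1}^{n}\frac{\epsilon_{i}}{\beta^{i}},\ \sum_{i=1}^{n}\frac{\epsilon_{i}}{\beta^{i}}+\Phi(n)\Big].$$ A number $\beta\in(1,2)$ is called approximation regular if for each $\Phi:\mathbb{N}\to\mathbb{R}_{\geq 0}$ satisfying $\sum_{n=1}^{\infty}2^{n}\Phi(n)=\infty$, the set $W_{\beta}(\Phi)$ has full Lebesgue measure within $I_{\beta}$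 (i.e. $I_\beta\setminus W_\beta(\Phi)$ is Lebesgue null). A function $\Psi:\mathbb{N}\to\mathbb{R}_{\geq 0}$ is decaying regularly if for each $m\in\mathbb{N}$ there exists $C_{m}\in\mathbb{N}$ (allowed to depend on $m$) such that $\frac{\Psi(n+m)}{\Psi(n)}\geq\frac{1}{C_{m}}$ for every $n\in\mathbb{N}$; the ratio is understood to make sense, so $\Psi(n)>0$ for all $n$. *)

(* Defs.v *)
From HB Require Import structures.
From mathcomp Require Import all_boot all_order all_algebra.
From mathcomp Require Import all_classical all_reals all_analysis.

Set Implicit Arguments.
Unset Strict Implicit.
Unset Printing Implicit Defensive.

Import Order.TTheory GRing.Theory Num.Theory.
Import numFieldNormedType.Exports.

Local Open Scope classical_set_scope.
Local Open Scope ring_scope.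

(* Indexing: N = {1, 2, ...}. Functions Phi, Psi on N are functions on nat
   whose value at 0 is never used. Digits are stored from 0: the digit
   epsilon_{i+1}, of weight beta^-(i+1), is [eps i]. *)

Definition I_beta (R : realType) (beta : R) : set R :=
  `[0, 1 / (beta - 1)]%classic.

Definition digit_sum (R : realType) (beta : R) (n : nat) (e : 'I_n -> bool) : R :=
  \sum_(i < n) (e i)%:R / beta ^+ i.+1.

Definition beta_expansion (R : realType) (beta : R) (eps : nat -> bool) (x : R) :
    Prop :=
  series (fun i => (eps i)%:R / beta ^+ i.+1 : R) @ \oo --> x.

Definition W (R : realType) (beta : R) (Phi : nat -> R) : set R :=
  \bigcap_(m in [set m | (0 < m)%N])
    \bigcup_(n in [set n | (m <= n)%N])
      \bigcup_(e in [set: n.-tuple bool])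
        `[digit_sum beta (tnth e), digit_sum beta (tnth e) + Phi n]%classic.

Definition nonneg_on_N (R : realType) (f : nat -> R) : Prop :=
  forall n, (0 < n)%N -> 0 <= f n.

Definition divergent_2n (R : realType) (f : nat -> R) : Prop :=
  (\sum_(1 <= n <oo) (2 ^+ n * f n)%:E = +oo)%E.

Definition approximation_regular (R : realType) (beta : R) : Prop :=
  1 < beta < 2 /\
  forall Phi : nat -> R, nonneg_on_N Phi -> divergent_2n Phi ->
    (@lebesgue_measure R).-negligible (I_beta beta `\` W beta Phi).

Definition decaying_regularly (R : realType) (Psi : nat -> R) : Prop :=
  (forall n, (0 < n)%N -> 0 < Psi n) /\
  forall m, (0 < m)%N -> exists2 C : nat, (0 < C)%N &
    forall n, (0 < n)%N -> Psi (n + m)%N / Psi n >= 1 / C%:R.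

(* Main.v *)
Require Import Defs.
From HB Require Import structures.
From mathcomp Require Import all_boot all_order all_algebra.
From mathcomp Require Import all_classical all_reals all_analysis.
From mathcomp Require Import measurable_realfun ring lra.

Set Implicit Arguments.
Unset Strict Implicit.

Import Order.TTheory GRing.Theory Num.Theory.
Import numFieldNormedType.Exports.

Local Open Scope classical_set_scope.
Local Open Scope ring_scope.

(** Approximation regularity gives, for almost every x, infinitely many words
    whose sums approximate x from below, but these words need not be prefixes
    of one expansion. They can be made so by restarting. If a word s has been
    chosen, the remainder y = beta^|s| (x - sum of s) is again a point to be
    expanded, and a word t appended to s approximates x within Psi(|s| + |t|)
    exactly when t approximates y within Phi(|t|), where
    Phi(n) = beta^|s| Psi(n + |s|). The series of the 2^n Phi(n) is, up to a
    positive factor, a tail of the series of the 2^n Psi(n), so it diverges and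
    W(Phi) has full measure: the y in I_beta that admit no such t form a null
    set. The affine map from x to y pulls null sets back to null sets
    ([negligible_affine_preimage]), and there are only countably many words s,
    so outside one null set every word s with remainder in I_beta can be
    extended to a longer word that again approximates x ([ae_never_stuck]).

    To iterate, the new remainder must lie in I_beta again, that is, the error
    after n digits must be at most beta^-n / (beta - 1). For this, Psi is first
    replaced by its minimum with that bound. Divergence survives
    ([divergent_2n_min]), because 2^n beta^-n is unbounded. Starting from the
    empty word this yields an infinite chain of prefixes; its limit sequence
    meets the inequalities at the length of every prefix, and since those
    errors tend to 0 and partial sums increase, it is an expansion of x
    ([limit_expansion]). *)

(** * Null sets under affine maps *)

Section AffineMaps.
Context {R : realType}.

(** Both sides are measures in A, so it suffices to compare them on half-open
    intervals, which determine Lebesgue measure. *)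
Lemma lebesgue_measure_affine (c t : R) (A : set R) : 0 < c -> measurable A ->
  lebesgue_measure A =
  (c%:E * lebesgue_measure ((fun x : R => (c * (x - t))%R) @^-1` A))%E.
Proof.
move=> c0 mA.
pose f : measurableTypeR R -> measurableTypeR R := fun x => c * (x - t).
have mf : measurable_fun setT f.
  by apply: measurable_funM => //; apply: measurable_funB.
pose mu := mscale (NngNum (ltW c0)) (pushforward (@lebesgue_measure R) f).
rewrite (@lebesgue_measure_unique _ (mu mf))//= => _ [[a b]] _ <-.
rewrite /mu /mscale/= /pushforward.
rewrite (_ : _ @^-1` _ = `](c^-1 * a + t), (c^-1 * b + t)]%classic); last first.
  apply/seteqP; split => x /=; rewrite !in_itv/= /f.
    by rewrite -ltrBrDr -lerBlDr ltr_pdivrMl// ler_pdivlMl.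
  by rewrite -ltrBrDr -lerBlDr ltr_pdivrMl// ler_pdivlMl.
rewrite !lebesgue_measure_itv/= !lte_fin ltrD2r ltr_pM2l ?invr_gt0//.
case: ifPn => _; last by rewrite mule0.
by rewrite -!EFinB -EFinM; congr EFin; field; lra.
Qed.

Lemma negligible_affine_preimage (c t : R) (N : set R) : 0 < c ->
  (@lebesgue_measure R).-negligible N ->
  (@lebesgue_measure R).-negligible ((fun x => c * (x - t)) @^-1` N).
Proof.
move=> c0 [A [mA A0 NA]]; exists ((fun x => c * (x - t)) @^-1` A); split.
- rewrite -[X in measurable X]setTI.
  have mf : measurable_fun setT (fun x : R => c * (x - t)).
    by apply: measurable_funM => //; apply: measurable_funB.
  exact: mf.
- have := lebesgue_measure_affine t c0 mA; rewrite A0 => /esym/eqP.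
  by rewrite mule_eq0 eqe gt_eqF//= => /eqP.
- exact: preimage_subset.
Qed.

End AffineMaps.

(** * Divergence of the series of 2^n f(n) *)

Section Divergence.
Context {R : realType}.

Lemma divergent_2nP (f : nat -> R) : nonneg_on_N f ->
  divergent_2n f <-> forall A, exists n, A <= \sum_(1 <= i < n) 2 ^+ i * f i.
Proof.
move=> f0.
have F0 n : (1 <= n)%N -> true -> (0 <= (2 ^+ n * f n)%:E)%E.
  by move=> n1 _; rewrite lee_fin mulr_ge0// f0.
split=> [fdiv A|unb].
- apply: contrapT => /forallNP nA.
  have : (\sum_(1 <= n <oo) (2 ^+ n * f n)%:E <= A%:E)%E.
    apply: lime_le; first by apply: is_cvg_nneseries => n n1 _; exact: F0.
    apply: nearW => n; rewrite sumEFin lee_fin ltW// ltNge; exact/negP.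
  by rewrite fdiv leye_eq.
- apply: eq_infty => A.
  have [n An] := unb A.
  apply: le_trans (nneseries_lim_ge n F0).
  by rewrite sumEFin lee_fin.
Qed.

(** Divergence depends only on the tail of a series and is insensitive to
    positive factors and to shifts of the index: a shift by m merely multiplies
    the weights 2^n by 2^m. *)
Lemma divergent_2n_le_shift (c : R) (m N : nat) (f g : nat -> R) : 0 < c ->
  nonneg_on_N f -> nonneg_on_N g ->
  (forall n, (N <= n)%N -> c * f (n + m)%N <= g n) ->
  divergent_2n f -> divergent_2n g.
Proof.
move=> c0 f0 g0 fg /(divergent_2nP f0) fdiv; apply/(divergent_2nP g0) => A.
pose F i := 2 ^+ i * f i; pose G i := 2 ^+ i * g i.
have F0 i : (0 < i)%N -> 0 <= F i by move=> i0; rewrite mulr_ge0// f0.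
have G0 i : (0 < i)%N -> 0 <= G i by move=> i0; rewrite mulr_ge0// g0.
have [n An] := fdiv (c^-1 * 2 ^+ m * A + \sum_(1 <= i < N.+1 + m) F i).
(* The summands below index N.+1 + m are not controlled by g: their sum was
   added to the bound asked of f, and the remaining n summands are compared. *)
exists (N.+1 + n)%N.
have le1 : \sum_(1 <= i < n) F i <= \sum_(1 <= i < N.+1 + n + m) F i.
  case: n {An} => [|n]; first by rewrite big_geq// big_nat
    sumr_ge0// => i /andP[/F0].
  rewrite [leRHS](@big_cat_nat _ _ _ n.+1)//=; last first.
    by rewrite addnAC addnC leq_addr.
  rewrite lerDl big_nat sumr_ge0// => i /andP[ni _].
  by rewrite F0// (leq_trans _ ni).
have : c^-1 * 2 ^+ m * A <= \sum_(N.+1 + m <= i < N.+1 + n + m) F i.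
  have := le_trans An le1.
  rewrite [leRHS](@big_cat_nat _ _ _ (N.+1 + m))//=; last first.
    by rewrite leq_add2r leq_addr.
  by rewrite [leRHS]addrC lerD2r.
rewrite big_addn addnK => le2.
have le3 : \sum_(N.+1 <= i < N.+1 + n) F (i + m)%N <=
    c^-1 * 2 ^+ m * \sum_(N.+1 <= i < N.+1 + n) G i.
  rewrite mulr_sumr big_nat [leRHS]big_nat ler_sum// => i /andP[Ni _].
  rewrite /F /G exprD -mulrA mulrCA.
  rewrite [leRHS](_ : _ = 2 ^+ i * (2 ^+ m * (c^-1 * g i))); last by ring.
  rewrite [leLHS](_ : _ = 2 ^+ i * (2 ^+ m * f (i + m)%N)); last by ring.
  rewrite !ler_pM2l ?exprn_gt0// ler_pdivlMl//.
  by apply: fg; exact: ltnW.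
have := le_trans le2 le3; rewrite ler_pM2l ?mulr_gt0 ?invr_gt0 ?exprn_gt0//.
move=> /le_trans; apply.
rewrite [leRHS](@big_cat_nat _ _ _ N.+1)//= ?leq_addr//.
by rewrite lerDr big_nat sumr_ge0// => i /andP[/G0].
Qed.

(** If the minimum is eventually f, the tails agree. Otherwise it equals
    c / beta^n for arbitrarily large n, and the single summand c (2 / beta)^n
    already exceeds any bound because beta < 2. *)
Lemma divergent_2n_min (beta c : R) (f : nat -> R) : 0 < beta < 2 -> 0 < c ->
  nonneg_on_N f -> divergent_2n f ->
  divergent_2n (fun n => Num.min (f n) (c / beta ^+ n)).
Proof.
move=> /andP[b0 b2] c0 f0 fdiv; set g := fun n => _.
have bn0 n : 0 < c / beta ^+ n by rewrite divr_gt0// exprn_gt0.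
have g0 : nonneg_on_N g.
  by move=> n n0; rewrite /g le_min f0//= ltW.
have [[N small]|large] :=
    pselect (exists N, forall n, (N <= n)%N -> f n <= c / beta ^+ n).
  apply: (@divergent_2n_le_shift 1 0 N f) => // n Nn.
  by rewrite mul1r addn0 /g le_min lexx small.
apply/(divergent_2nP g0) => A.
have [N AN] : exists N, forall n, (N <= n)%N -> A <= c * (2 / beta) ^+ n.
  have b2lt1 : `|beta / 2| < 1.
    by rewrite ger0_norm ?divr_ge0 1?ltW// ltr_pdivrMr// mul1r.
  have [N _ AN] := cvgr_lt _ (cvg_geometric A b2lt1) _ c0.
  exists N => n /AN/= /ltW; rewrite -ler_pdivlMr ?exprn_gt0 ?divr_gt0//.
  by rewrite -exprVn invf_div.
move/forallNP: large => /(_ N.+1) /existsNP[n] /not_implyP[Nn] /negP.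
rewrite -ltNge => fn.
exists n.+1; rewrite big_nat_recr/=; last by rewrite (leq_trans _ Nn).
rewrite ler_wpDl//.
  by rewrite big_nat sumr_ge0// => i /andP[i0 _]; rewrite mulr_ge0// g0.
rewrite /g min_r; last exact: ltW.
by rewrite mulrCA -expr_div_n AN// ltnW.
Qed.

End Divergence.

(** * Finite words *)

Section Words.
Context {R : realType}.

Definition word_sum (beta : R) (s : seq bool) : R :=
  digit_sum beta (fun i : 'I_(size s) => nth false s i).

Lemma digit_sumE (beta : R) (eps : nat -> bool) n :
  digit_sum beta (fun i : 'I_n => eps i) =
  \sum_(0 <= i < n) (eps i)%:R / beta ^+ i.+1.
Proof. by rewrite /digit_sum big_mkord. Qed.

Lemma word_sum_tuple (beta : R) n (e : n.-tuple bool) :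
  digit_sum beta (tnth e) = word_sum beta e.
Proof.
rewrite /word_sum digit_sumE size_tuple big_mkord; apply: eq_bigr => i _.
by rewrite (tnth_nth false).
Qed.

Lemma word_sum_cat (beta : R) s t :
  word_sum beta (s ++ t) = word_sum beta s + word_sum beta t / beta ^+ size s.
Proof.
rewrite /word_sum !digit_sumE size_cat.
rewrite (@big_cat_nat _ _ _ (size s))//= ?leq_addr//.
congr (_ + _).
  rewrite big_nat [RHS]big_nat; apply: eq_bigr => i /andP[_ si].
  by rewrite nth_cat si.
rewrite -{1}[size s]add0n big_addn addKn mulr_suml; apply: eq_bigr => i _.
by rewrite nth_cat ltnNge leq_addl/= addnK -addSn exprD invfM mulrA.
Qed.

End Words.

(** * Extending a word *)

Section Extension.
Context {R : realType}.
Implicit Types (beta x : R) (f : nat -> R) (s t : seq bool).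

Definition remainder beta s x : R := beta ^+ size s * (x - word_sum beta s).

Definition approximated beta f x s : Prop :=
  0 <= x - word_sum beta s <= f (size s).

Lemma remainder_cat beta s t x : beta != 0 ->
  beta ^+ size s * (x - word_sum beta (s ++ t)) =
  remainder beta s x - word_sum beta t.
Proof.
move=> b0; rewrite word_sum_cat /remainder.
have : beta ^+ size s != 0 by rewrite expf_neq0.
by move=> bs0; field.
Qed.

(** The points x at which the construction would have to stop after s. *)
Definition stuck beta f s : set R := [set x |
  I_beta beta (remainder beta s x) /\
  ~ exists2 t, (0 < size t)%N & approximated beta f x (s ++ t)].

(** The remainder of a point of [stuck] lies in I_beta but outside W(Phi), where
    Phi rescales f after the prefix s; the index m = 1 in the definition of W
    is what makes the appended word nonempty. *)
Lemma negligible_stuck beta f s :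
  approximation_regular beta -> nonneg_on_N f -> divergent_2n f ->
  (@lebesgue_measure R).-negligible (stuck beta f s).
Proof.
move=> [/andP[b1 _] hreg] f0 fdiv.
have b0 : 0 < beta by rewrite (lt_trans _ b1).
have bs0 : 0 < beta ^+ size s by rewrite exprn_gt0.
pose Phi n := beta ^+ size s * f (n + size s)%N.
have Phi0 : nonneg_on_N Phi.
  by move=> n n0; rewrite mulr_ge0 ?(ltW bs0)// f0// addn_gt0 n0.
have Phidiv : divergent_2n Phi.
  exact: (@divergent_2n_le_shift _ (beta ^+ size s) (size s) 0 f).
have := hreg _ Phi0 Phidiv.
move=> /(negligible_affine_preimage (word_sum beta s) bs0).
apply: negligibleS => x [yI noext]; split=> // yW; apply: noext.
have [n n1 [e _]] := yW 1%N isT.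
rewrite /= in_itv/= word_sum_tuple => /andP[ey ye].
exists e; first by rewrite size_tuple.
have bn0 : beta != 0 by rewrite gt_eqF.
apply/andP; split.
  by rewrite -(pmulr_rge0 _ bs0) remainder_cat// subr_ge0.
rewrite -(ler_pM2l bs0) remainder_cat// lerBlDl.
by rewrite size_cat size_tuple addnC.
Qed.

(** This is what allows the restart: an approximation that is no worse than the
    largest possible tail of an expansion leaves a remainder in I_beta. *)
Lemma approximated_remainder beta f x s : 0 < beta ->
  f (size s) <= (beta - 1)^-1 / beta ^+ size s ->
  approximated beta f x s -> I_beta beta (remainder beta s x).
Proof.
move=> b0 fs /andP[xs0 xs]; have bs0 : 0 < beta ^+ size s by rewrite exprn_gt0.
rewrite /I_beta /= in_itv/= /remainder pmulr_rge0// xs0/= mul1r mulrC.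
by rewrite -ler_pdivlMr// (le_trans xs).
Qed.

End Extension.

(** * The limit of a chain of words *)

Section Gluing.
Context {R : realType}.
Variables (s t : nat -> seq bool).
Hypotheses (s_ext : forall k, s k.+1 = s k ++ t k)
  (t_neq0 : forall k, (0 < size (t k))%N).

(* The digit of index i is read in [s i.+1], the first member of the chain whose
   length is known to exceed i. *)
Let eps i := nth false (s i.+1) i.

Lemma size_chain_lt k : (size (s k) < size (s k.+1))%N.
Proof. by rewrite s_ext size_cat -{1}[size (s k)]addn0 ltn_add2l. Qed.

Lemma leq_size_chain k : (k <= size (s k))%N.
Proof. by elim: k => // k IH; rewrite (leq_ltn_trans IH)// size_chain_lt. Qed.

Lemma nth_chain k n i : (i < size (s k))%N ->
  nth false (s (k + n)%N) i = nth false (s k) i.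
Proof.
elim: n => [|n IH] ik; first by rewrite addn0.
rewrite addnS s_ext nth_cat IH// ifT// (leq_trans ik)//.
elim: n {IH} => [|n IH]; first by rewrite addn0.
by rewrite addnS (leq_trans IH)// ltnW// size_chain_lt.
Qed.

Lemma nth_limit k i : (i < size (s k))%N -> eps i = nth false (s k) i.
Proof.
move=> isk; rewrite /eps; have [ki|ik] := leqP k i.+1.
  by rewrite -(subnKC ki) nth_chain.
by rewrite -(subnKC (ltnW ik)) nth_chain// leq_size_chain.
Qed.

Lemma digit_sum_limit (beta : R) k :
  digit_sum beta (fun i : 'I_(size (s k)) => eps i) = word_sum beta (s k).
Proof. by apply: eq_bigr => i _; rewrite (@nth_limit k). Qed.

(** Along the lengths of the chain the partial sums come within
    beta^-n / (beta - 1) of x; being nondecreasing, they converge to x along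
    all indices. *)
Lemma limit_expansion (beta x : R) (f : nat -> R) : 1 < beta ->
  (forall n, f n <= (beta - 1)^-1 / beta ^+ n) ->
  (forall k, approximated beta f x (s k.+1)) ->
  beta_expansion beta eps x /\ infinite_set [set n : nat | (0 < n)%N /\
    0 <= x - digit_sum beta (fun i : 'I_n => eps i) <= f n].
Proof.
move=> b1 fle sapp; have b0 : 0 < beta by rewrite (lt_trans _ b1).
split.
- pose S := series (fun i => (eps i)%:R / beta ^+ i.+1 : R).
  have S_mono : nondecreasing_seq S.
    by apply: nondecreasing_series => i _ _; rewrite divr_ge0// exprn_ge0// ltW.
  have SE k : S (size (s k)) = word_sum beta (s k).
    by rewrite -digit_sum_limit digit_sumE.
  have S_le n : S n <= x.
    have /andP[+ _] := sapp n; rewrite subr_ge0 -SE; apply: le_trans.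
    by apply: S_mono; apply: leq_trans (leq_size_chain _).
  apply/cvgrPdist_le => e e0.
  have binv : `|beta^-1| < 1 by rewrite ger0_norm ?invr_ge0 1?ltW// invf_lt1.
  have [k _ small] := cvgr_lt _ (cvg_geometric (beta - 1)^-1 binv) _ e0.
  exists (size (s k.+1)) => // n /= kn.
  rewrite ger0_norm ?subr_ge0//.
  have /andP[_ xk] := sapp k.
  apply: (@le_trans _ _ (x - word_sum beta (s k.+1))).
    by rewrite lerD2l lerN2 -SE S_mono.
  apply: le_trans xk (le_trans (fle _) _).
  rewrite -exprVn ltW//; apply: small => /=.
  by apply: leq_trans (leq_size_chain _).
- apply: (@sub_infinite_set _ (range (fun k => size (s k.+1)))).
    move=> _ [k _ <-]; split; first by rewrite (leq_trans _ (leq_size_chain _)).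
    by rewrite digit_sum_limit; exact: sapp.
  have inj : {in [set: nat] &, injective (fun k => size (s k.+1))}.
    apply: in2W; apply: incn_inj; apply: leq_mono; apply: homo_ltn => //.
      exact: ltn_trans.
    by move=> k; exact: size_chain_lt.
  by rewrite (eq_finite_set (inj_card_eq inj)); exact: infinite_nat.
Qed.

End Gluing.

(** * Almost every point *)

Lemma ae_never_stuck {R : realType} (beta : R) (f : nat -> R) :
  approximation_regular beta -> nonneg_on_N f -> divergent_2n f ->
  {ae (@lebesgue_measure R), forall x, forall s, ~ stuck beta f s x}.
Proof.
move=> breg f0 fdiv.
pose N k := if unpickle k is Some s then stuck beta f s else set0.
have NN k : (@lebesgue_measure R).-negligible (N k).
  rewrite /N; case: unpickle => [s|]; first exact: negligible_stuck.
  exact: negligible_set0.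
apply: negligibleS (negligible_bigcup NN).
move=> x /= /existsNP[s /contrapT xs].
by exists (pickle s) => //; rewrite /N pickleK.
Qed.

Theorem theorem1p4 (R : realType) (beta : R) (Psi : nat -> R)
  (hbeta : 1 < beta < 2) (hreg : approximation_regular beta)
  (hPsi : nonneg_on_N Psi) (hdecay : decaying_regularly Psi)
  (hdiv : divergent_2n Psi) :
  {ae (@lebesgue_measure R), forall x, I_beta beta x ->
    exists2 eps : nat -> bool, beta_expansion beta eps x &
      infinite_set [set n : nat | (0 < n)%N /\
        0 <= x - digit_sum beta (fun i : 'I_n => eps i) <= Psi n]}.
Proof.
have /andP[b1 b2] := hbeta.
have b0 : 0 < beta by rewrite (lt_trans _ b1).
have c0 : 0 < (beta - 1)^-1 by rewrite invr_gt0 subr_gt0.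
(* The second argument is the largest possible tail after n digits. *)
pose f n := Num.min (Psi n) ((beta - 1)^-1 / beta ^+ n).
have f0 : nonneg_on_N f.
  by move=> n n0; rewrite le_min hPsi//= divr_ge0 ?exprn_ge0// ltW.
have fle n : f n <= (beta - 1)^-1 / beta ^+ n by rewrite ge_min lexx orbT.
have fdiv : divergent_2n f by apply: divergent_2n_min => //; rewrite b0.
apply: negligibleS (ae_never_stuck hreg f0 fdiv); apply: subsetC => x /= xN xI.
have step s : exists t, I_beta beta (remainder beta s x) ->
    (0 < size t)%N /\ approximated beta f x (s ++ t).
  have [sI|] := pselect (I_beta beta (remainder beta s x)); last by exists [::].
  have /not_andP[//|/contrapT[t t0 xt]] := xN s.
  by exists t.
have [ext extP] := choice step.
pose s := fix s k := if k is k'.+1 then s k' ++ ext (s k') else [::].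
have sI k : I_beta beta (remainder beta (s k) x).
  elim: k => [|k /extP[_]]; last exact: approximated_remainder.
  by rewrite /remainder /word_sum digit_sumE big_geq// subr0 mul1r.
have [] := @limit_expansion R s (ext \o s) _ _ beta x f b1 fle _ => //.
- by move=> k; have [] := extP _ (sI k).
- by move=> k; have [] := extP _ (sI k).
move=> xeps inf; exists (fun i => nth false (s i.+1) i) => //.
apply: sub_infinite_set inf => n [n0 /andP[xn0 xn]]; split => //.
by rewrite xn0 (le_trans xn)// ge_min lexx.
Qed.
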